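(* Let $n\ge 1$ and let $\mathcal{A},\mathcal{B},\mathcal{C}$ be real $n\times n$ matrices that are invertible and hyperbolic, with $\mathcal{C}=\mathcal{A}+\mathcal{B}$ and $\lambda_n^{\mathcal{C}}>\lambda_n^{\mathcal{A}}+\lambda_n^{\mathcal{B}}$, where $\lambda_n^{\mathcal{M}}$ denotes the greatest eigenvalue of a hyperbolic matrix $\mathcal{M}$. Let $X=\mathrm{C}_{\mathrm{ub}}(\mathbb{R},\mathbb{R}^n)$ and let $(S(t))_{t\ge 0}$, $(T(t))_{t\ge 0}$, $(U(t))_{t\ge 0}$ be the strongly continuous semigroups on $X$ associated with $\mathcal{A}$, $\mathcal{B}$, $\mathcal{C}$ respectively, i.e. for $t\ge 0$, $x\in\mathbb{R}$, $f\in X$, $$[S(t)f](x)=\sum_{i=1}^n\langle l_i^{\mathcal{A}},f(x+\lambda_i^{\mathcal{A}}t)\rangle r_i^{\mathcal{A}},\quad [T(t)f](x)=\sum_{i=1}^n\langle l_i^{\mathcal{B}},f(x+\lambda_i^{\mathcal{B}}t)\rangle r_i^{\mathcal{B}},\quad [U(t)f](x)=\sum_{i=1}^n\langle l_i^{\mathcal{C}},f(x+\lambda_i^{\mathcal{C}}t)\rangle r_i^{\mathcal{C}}.$$ Then $(U(t))_{t\ge 0}$ is not given by the Trotter product formula of $(S(t))_{t\ge 0}$ and $(T(t))_{t\ge 0}$: there exists a function $f\in X$ such that, for every $t>0$, $$U(t)f\neq\lim_{m\to+\infty}\left(S\left(\tfrac{t}{m}\right)T\left(\tfrac{t}{m}\right)\right)^m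 f,$$ that is, the sequence $\left(S(t/m)T(t/m)\right)^m f$, $m\ge 1$, does not converge to $U(t)f$ in $X$.
   Context: $X=\mathrm{C}_{\mathrm{ub}}(\mathbb{R},\mathbb{R}^n)$ is the Banach space of all bounded and uniformly continuous functions $f:\mathbb{R}\to\mathbb{R}^n$ with norm $\|f\|_X=\sup_{x\in\mathbb{R}}\|f(x)\|$, where $\|\cdot\|$ is the Euclidean norm on $\mathbb{R}^n$ and $\langle\cdot,\cdot\rangle$ is the standard scalar product on $\mathbb{R}^n$. A real $n\times n$ matrix $\mathcal{M}$ is called hyperbolic if it is diagonalizable over $\mathbb{R}$ (with real eigenvalues). For a hyperbolic matrix $\mathcal{M}$, $\lambda_1^{\mathcal{M}}\le\dots\le\lambda_n^{\mathcal{M}}$ denote its eigenvalues (with multiplicity), and $r_1^{\mathcal{M}},\dots,r_n^{\mathcal{M}}$ and $l_1^{\mathcal{M}},\dots,l_n^{\mathcal{M}}$ denote corresponding right and left eigenvectors, normalized so that $\|r_i^{\mathcal{M}}\|=1$ for all $i$ and $\langle l_j^{\mathcal{M}},r_i^{\mathcal{M}}\rangle=\delta_{i,j}$ (Kronecker delta) for all $i,j$. *)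

(* Defs.v *)
From HB Require Import structures.
From mathcomp Require Import all_boot all_order all_algebra.
From mathcomp Require Import perm ring.
From mathcomp Require Import all_classical all_reals all_analysis.

Set Implicit Arguments.
Unset Strict Implicit.
Unset Printing Implicit Defensive.

Import Order.TTheory GRing.Theory Num.Theory.
Import numFieldNormedType.Exports.

Local Open Scope classical_set_scope.
Local Open Scope ring_scope.

(* The canonical norm on ['cV[R]_n] is the max norm [mx_norm], hence the separate
   Euclidean norm below. *)
Section Euclidean.
Context {R : realType} {n : nat}.
Implicit Types u v w : 'cV[R]_n.

Definition dotv u v : R := \sum_(i < n) u i 0 * v i 0.

Definition enorm u : R := Num.sqrt (dotv u u).

Lemma dotvC u v : dotv u v = dotv v u.
Proof. by apply: eq_bigr => i _; rewrite mulrC. Qed.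

Lemma dotvDr u v w : dotv u (v + w) = dotv u v + dotv u w.
Proof.
by rewrite /dotv -big_split; apply: eq_bigr => i _; rewrite mxE mulrDr.
Qed.

Lemma dotvZr a u v : dotv u (a *: v) = a * dotv u v.
Proof. by rewrite /dotv mulr_sumr; apply: eq_bigr => i _; rewrite mxE mulrCA. Qed.

Lemma dotvDl u v w : dotv (u + v) w = dotv u w + dotv v w.
Proof. by rewrite !(dotvC _ w) dotvDr. Qed.

Lemma dotvZl a u v : dotv (a *: u) v = a * dotv u v.
Proof. by rewrite !(dotvC _ v) dotvZr. Qed.

Lemma dotv_ge0 u : 0 <= dotv u u.
Proof. by apply: sumr_ge0 => i _; rewrite -expr2 sqr_ge0. Qed.

Lemma enorm_ge0 u : 0 <= enorm u.
Proof. exact: sqrtr_ge0. Qed.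

Lemma enorm_sqr u : enorm u ^+ 2 = dotv u u.
Proof. by rewrite sqr_sqrtr // dotv_ge0. Qed.

Lemma enorm0_eq0 u : enorm u = 0 -> u = 0.
Proof.
move=> u0; have /eqP : dotv u u = 0 by rewrite -enorm_sqr u0 expr0n.
rewrite psumr_eq0 => [/allP u00|i _]; last by rewrite -expr2 sqr_ge0.
apply/colP => i; rewrite mxE; apply/eqP.
by have := u00 i (mem_index_enum _); rewrite -expr2 sqrf_eq0.
Qed.

Lemma enormZ a u : enorm (a *: u) = `|a| * enorm u.
Proof.
by rewrite /enorm dotvZl dotvZr mulrA -expr2 sqrtrM ?sqr_ge0// sqrtr_sqr.
Qed.

Lemma enorm0 : enorm 0 = 0.
Proof. by rewrite -(scale0r (0 : 'cV_n)) enormZ normr0 mul0r. Qed.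

Lemma dotv_le u v : dotv u v <= enorm u * enorm v.
Proof.
have [/enorm0_eq0 ->|u0] := eqVneq (enorm u) 0.
  by rewrite enorm0 mul0r -(scale0r (0 : 'cV_n)) dotvZl mul0r.
have [/enorm0_eq0 ->|v0] := eqVneq (enorm v) 0.
  by rewrite enorm0 mulr0 -(scale0r (0 : 'cV_n)) dotvZr mul0r.
have uv0 : 0 < enorm u * enorm v.
  by rewrite mulr_gt0// lt_def ?u0 ?v0 enorm_ge0.
have := dotv_ge0 (enorm v *: u + (- enorm u) *: v).
rewrite !(dotvDl, dotvDr, dotvZl, dotvZr) -!enorm_sqr (dotvC v u).
set a := enorm u in uv0 *; set b := enorm v in uv0 *; set d := dotv u v.
rewrite [X in 0 <= X](_ : _ = (a * b) * (a * b - d) *+ 2); last by ring.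
by rewrite pmulrn_lge0// pmulr_rge0// subr_ge0.
Qed.

Lemma ler_dotv u v : `|dotv u v| <= enorm u * enorm v.
Proof.
rewrite ler_norml dotv_le andbT lerNl -mulN1r -dotvZl.
by rewrite (le_trans (dotv_le _ _))// enormZ normrN1 mul1r.
Qed.

Lemma ler_enormD u v : enorm (u + v) <= enorm u + enorm v.
Proof.
rewrite -(@ler_pXn2r _ 2) ?nnegrE ?addr_ge0 ?enorm_ge0//.
rewrite enorm_sqr dotvDl !dotvDr sqrrD -!enorm_sqr (dotvC v u).
by rewrite addrA lerD2r -addrA lerD2l -mulr2n lerMn2r dotv_le.
Qed.

End Euclidean.

Section Cub.
Context (R : realType) (n : nat).

Definition is_cub (f : R -> 'cV[R]_n) : Prop :=
  (exists M : R, forall x, enorm (f x) <= M) /\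
  (forall e : R, 0 < e -> exists2 d : R, 0 < d &
     forall x y, `|x - y| < d -> enorm (f x - f y) < e).

Definition cub : {pred R -> 'cV[R]_n} := fun f => `[< is_cub f >].

Lemma is_cubZ (a : R) f : is_cub f -> is_cub (a *: f).
Proof.
move=> [[M fM] uf]; split.
  by exists (`|a| * M) => x; rewrite enormZ ler_wpM2l.
move=> e e0; have a1 : 0 < `|a| + 1 by rewrite ltr_wpDl.
have [d d0 fd] := uf (e / (`|a| + 1)) (divr_gt0 e0 a1).
exists d => // x y /fd xy; rewrite -scalerBr enormZ.
rewrite (@le_lt_trans _ _ ((`|a| + 1) * enorm (f x - f y)))//.
  by rewrite ler_wpM2r ?enorm_ge0// lerDl.
by rewrite mulrC -ltr_pdivlMr.
Qed.

Lemma is_cubD f g : is_cub f -> is_cub g -> is_cub (f + g).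
Proof.
move=> [[M fM] uf] [[N gN] ug]; split.
  by exists (M + N) => x; rewrite (le_trans (ler_enormD _ _))// lerD.
move=> e e0; have e20 : 0 < e / 2 by rewrite divr_gt0.
have [d d0 fd] := uf _ e20; have [d' d'0 gd] := ug _ e20.
exists (Num.min d d') => [|x y]; first by rewrite lt_min d0 d'0.
rewrite lt_min => /andP[/fd xy /gd xy'].
rewrite [X in enorm X](_ : _ = (f x - f y) + (g x - g y)).
  by rewrite (le_lt_trans (ler_enormD _ _))// [e]splitr ltrD.
by rewrite opprD addrACA.
Qed.

Lemma is_cub0 : is_cub 0.
Proof.
split; first by exists 0 => x; rewrite enorm0.
by move=> e e0; exists 1 => // x y _; rewrite subrr enorm0.
Qed.

Lemma cub_submod_closed : submod_closed cub.
Proof.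
split; first exact/asboolP/is_cub0.
by move=> a f g /asboolP fX /asboolP gX; apply/asboolP/is_cubD/gX/is_cubZ.
Qed.

HB.instance Definition _ :=
  GRing.isSubmodClosed.Build R (R -> 'cV[R]_n) cub cub_submod_closed.

(* The space X of bounded uniformly continuous functions, made below a normed
   module for the sup norm of the Euclidean norm. *)
Record Cub := MkCub { cubfun :> R -> 'cV[R]_n; cubP : cubfun \in cub }.

HB.instance Definition _ := [isSub for cubfun].
HB.instance Definition _ := [Choice of Cub by <:].
HB.instance Definition _ := [SubChoice_isSubLmodule of Cub by <:].

Implicit Types f g : Cub.

Lemma cub_is_cub f : is_cub f.
Proof. exact/asboolP/cubP. Qed.

Definition supnorm f : R := sup (range (fun x => enorm (f x))).

Lemma enorm_le_supnorm f x : enorm (f x) <= supnorm f.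
Proof.
have [[M fM] _] := cub_is_cub f.
by apply: ub_le_sup; [exists M => _ [y _ <-]|exists x].
Qed.

Lemma supnorm_le f (M : R) : (forall x, enorm (f x) <= M) -> supnorm f <= M.
Proof. by move=> fM; apply: ge_sup => [|_ [y _ <-]//]; exists (enorm (f 0)), 0. Qed.

Lemma ler_supnormD f g : supnorm (f + g) <= supnorm f + supnorm g.
Proof.
apply: supnorm_le => x; rewrite (le_trans (ler_enormD _ _))//.
by rewrite lerD ?enorm_le_supnorm.
Qed.

Lemma supnormZ (a : R) f : supnorm (a *: f) = `|a| * supnorm f.
Proof.
have le b g : supnorm (b *: g) <= `|b| * supnorm g.
  by apply: supnorm_le => x; rewrite enormZ ler_wpM2l ?enorm_le_supnorm.
apply/eqP; rewrite eq_le le /=.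
have [->|a0] := eqVneq a 0.
  by rewrite normr0 mul0r (le_trans (enorm_ge0 _) (enorm_le_supnorm _ 0)).
by rewrite -ler_pdivlMl ?normr_gt0// -normfV (le_trans _ (le _ _))// scalerK.
Qed.

Lemma supnorm0_eq0 f : supnorm f = 0 -> f = 0.
Proof.
move=> f0; apply/val_inj/funext => x; apply: enorm0_eq0; apply/eqP.
by rewrite eq_le enorm_ge0 andbT -f0 enorm_le_supnorm.
Qed.

HB.instance Definition _ :=
  Lmodule_isNormed.Build R Cub ler_supnormD supnormZ supnorm0_eq0.

Lemma cub_normE f : `|f| = sup (range (fun x => enorm (f x))).
Proof. by []. Qed.

End Cub.

Section Hyperbolic.
Context {R : realType} {n : nat}.

(* [diagonalizable] refers to the field of coefficients, here [R], so the
   eigenvalues are real. *)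
Definition hyperbolic (M : 'M[R]_n) : Prop := diagonalizable M.

(* A choice of eigenvalues, listed with multiplicity in nondecreasing order (so
   that the last one is the greatest), and of normalized right and left
   eigenvectors. The left eigenvectors are stored as columns. Such a choice need
   not be unique; it exists by [hyperbolic_eigensystem] below. *)
Record eigensystem (M : 'M[R]_n) := EigenSystem {
  eigval : 'I_n -> R;
  reig : 'I_n -> 'cV[R]_n;
  leig : 'I_n -> 'cV[R]_n;
  eigval_nondecreasing : forall i j : 'I_n, (i <= j)%N -> eigval i <= eigval j;
  reigP : forall i, M *m reig i = eigval i *: reig i;
  leigP : forall i, (leig i)^T *m M = eigval i *: (leig i)^T;
  enorm_reig : forall i, enorm (reig i) = 1;
  dotv_leig_reig : forall i j, dotv (leig j) (reig i) = (i == j)%:R }.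

Lemma dotvE (u v : 'cV[R]_n) : dotv u v = (u^T *m v) 0 0.
Proof. by rewrite mxE; apply: eq_bigr => i _; rewrite mxE. Qed.

Lemma hyperbolic_eigensystem (M : 'M[R]_n) :
  hyperbolic M -> inhabited (eigensystem M).
Proof.
move=> [P Pu /(similar_diagLR Pu)[d]].
rewrite conjumx ?unitmx_inv// invmxK => ME.
have [p p_le] : exists p : 'S_n, forall i j : 'I_n, (i <= j)%N ->
    d 0 (p i) <= d 0 (p j).
  have /tuple_permP[p pE] :
    perm_eq (sort <=%R [tuple d 0 i | i < n]) [tuple d 0 i | i < n].
    by rewrite perm_sort.
  exists p => i j ij.
  have nthE k : d 0 (p k) = nth 0 (sort <=%R [tuple d 0 i | i < n]) k.
    by rewrite pE -tnth_nth !tnth_mktuple.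
  rewrite !nthE; apply: (sorted_leq_nth (@le_trans _ _) (@lexx _ _)) => //.
  - exact/sort_sorted/le_total.
  - by rewrite inE size_sort size_tuple.
  - by rewrite inE size_sort size_tuple.
pose c i := col (p i) (invmx P).
have colM m (A : 'M[R]_(m, n)) i : A *m c i = col (p i) (A *m invmx P).
  by rewrite /c !colE mulmxA.
have PM i : row (p i) P *m M = d 0 (p i) *: row (p i) P.
  rewrite -row_mul ME !mulmxA mulmxV// mul1mx.
  by apply/rowP => j; rewrite mul_diag_mx !mxE.
have MP i : M *m c i = d 0 (p i) *: c i.
  rewrite colM ME mulmxK//.
  by apply/colP => j; rewrite mul_mx_diag !mxE mulrC.
have rc i j : dotv (row (p j) P)^T (c i) = (i == j)%:R.
  rewrite dotvE trmxK colM -row_mul mulmxV// !mxE.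
  by rewrite (inj_eq perm_inj) eq_sym.
have c0 i : enorm (c i) != 0.
  apply/eqP => /enorm0_eq0 ci0; have := rc i i.
  rewrite ci0 eqxx -(scale0r (0 : 'cV_n)) dotvZr mul0r => /esym/eqP.
  by rewrite oner_eq0.
split; exists (fun i => d 0 (p i)) (fun i => (enorm (c i))^-1 *: c i)
  (fun i => enorm (c i) *: (row (p i) P)^T) => //.
- by move=> i; rewrite -scalemxAr MP !scalerA mulrC.
- by move=> i; rewrite linearZ/= trmxK -scalemxAl PM !scalerA mulrC.
- by move=> i; rewrite enormZ normfV ger0_norm ?enorm_ge0// mulVf.
- move=> i j; rewrite dotvZl dotvZr rc; case: eqVneq => [->|_].
    by rewrite mulr1 mulfV.
  by rewrite !mulr0.
Qed.

Section group.
Context {M : 'M[R]_n} (E : eigensystem M) (t : R).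

Definition semigroup_fun (f : R -> 'cV[R]_n) (x : R) : 'cV[R]_n :=
  \sum_(i < n) dotv (leig E i) (f (x + eigval E i * t)) *: reig E i.

Lemma semigroup_subproof (f : Cub R n) : semigroup_fun f \in @cub R n.
Proof.
rewrite [semigroup_fun f](_ : _ = \sum_(i < n) (fun x =>
    dotv (leig E i) (f (x + eigval E i * t)) *: reig E i)); last first.
  by apply/funext => x; rewrite fct_sumE.
apply: rpred_sum => i _; apply/asboolP.
have [[K fK] uf] := cub_is_cub f.
set l := leig E i; set a := eigval E i * t; split.
  exists (enorm l * K) => x; rewrite enormZ enorm_reig mulr1.
  by rewrite (le_trans (ler_dotv _ _))// ler_wpM2l ?enorm_ge0.
move=> e e0; have l1 : 0 < enorm l + 1 by rewrite ltr_wpDl ?enorm_ge0.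
have [d d0 fd] := uf (e / (enorm l + 1)) (divr_gt0 e0 l1).
exists d => // x y xy; rewrite -scalerBl enormZ enorm_reig mulr1.
have /fd : `|(x + a) - (y + a)| < d by rewrite opprD addrACA subrr addr0.
rewrite -mulN1r -dotvZr -dotvDr scaleN1r; set v := f _ - f _ => vd.
rewrite (le_lt_trans (ler_dotv _ _))//.
rewrite (@le_lt_trans _ _ ((enorm l + 1) * enorm v))//.
  by rewrite ler_wpM2r ?enorm_ge0// lerDl.
by rewrite mulrC -ltr_pdivlMr.
Qed.

(* Defined for every real [t]; only [0 <= t] is used. *)
Definition semigroup (f : Cub R n) : Cub R n := MkCub (semigroup_subproof f).

End group.
End Hyperbolic.

(* Main.v *)
(* In [m] steps of length [t / m] the Trotter product propagates data to the
   left by at most [(lambda_A + lambda_B) t], [lambda_M] being the greatest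
   eigenvalue, whereas [U t] transports a multiple of the top eigenvector of
   [C] by exactly [lambda_C t], which is larger. Hence for data along that
   eigenvector vanishing exactly on the left half-line, all Trotter products
   vanish at [x = - (lambda_A + lambda_B) t] and [U t f] does not. *)
Require Import Defs.
From HB Require Import structures.
From mathcomp Require Import all_boot all_order all_algebra.
From mathcomp Require Import ring lra.
From mathcomp Require Import all_classical all_reals all_analysis.

Set Implicit Arguments.
Unset Strict Implicit.
Unset Printing Implicit Defensive.

Import Order.TTheory GRing.Theory Num.Theory.
Import numFieldNormedType.Exports.

Local Open Scope classical_set_scope.
Local Open Scope ring_scope.

Section FinitePropagation.
Context {R : realType} {n : nat}.

Definition vanishes_upto (b : R) (f : Cub R n.+1) : Prop :=
  forall x, x <= b -> f x = 0.

(** Each summand samples [f] at [x + eigval E i * s], and since [0 <= s] none of these points lies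
    to the right of the one for [ord_max]. *)
Lemma semigroup_vanishes_upto (M : 'M[R]_n.+1) (E : eigensystem M) (s b : R)
    (f : Cub R n.+1) :
  0 <= s -> vanishes_upto b f ->
  vanishes_upto (b - eigval E ord_max * s) (semigroup E s f).
Proof.
move=> s0 fb x xb; rewrite /= /semigroup_fun big1// => i _.
rewrite fb; first by rewrite -(scale0r (0 : 'cV_n.+1)) dotvZr mul0r !scale0r.
rewrite -lerBrDr (le_trans xb)// lerD2l lerN2 ler_wpM2r//.
by rewrite eigval_nondecreasing// -ltnS ltn_ord.
Qed.

(** The one-step bounds add up by induction. With [s = t / m] the total shift no longer depends on
    [m]. *)
Lemma iter_semigroup_vanishes_upto (M N : 'M[R]_n.+1) (E : eigensystem M)
    (F : eigensystem N) (s b : R) (f : Cub R n.+1) (m : nat) :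
  0 <= s -> vanishes_upto b f ->
  vanishes_upto (b - (eigval E ord_max + eigval F ord_max) * (s *+ m))
    (iter m (semigroup E s \o semigroup F s) f).
Proof.
move=> s0 fb; elim: m => [|m IHm]; first by rewrite mulr0n mulr0 subr0.
have := semigroup_vanishes_upto (E := E) s0
  (semigroup_vanishes_upto (E := F) s0 IHm).
by congr vanishes_upto; rewrite mulrS; ring.
Qed.

End FinitePropagation.

Section RampFunction.
Context {R : realType} {n : nat}.

(** The cap at 1 makes the function bounded; for [v] nonzero its zero set is exactly the half-line
    [x <= 0]. *)
Definition ramp (v : 'cV[R]_n) (x : R) : 'cV[R]_n :=
  Num.min 1 (Num.max 0 x) *: v.

Lemma ramp_subproof (v : 'cV[R]_n) : ramp v \in @cub R n.
Proof.
apply/asboolP; split.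
  exists (enorm v) => x; rewrite enormZ ler_piMl ?enorm_ge0//.
  by rewrite ger0_norm ?ge_min ?lexx// le_min ler01 le_max lexx.
(* The added 1 keeps the denominator positive even for [v = 0]. *)
move=> e e0; have v1 : 0 < enorm v + 1 by rewrite ltr_wpDl ?enorm_ge0.
exists (e / (enorm v + 1)) => [|x y]; first by rewrite divr_gt0.
rewrite ltr_pdivlMr// => xy; rewrite -scalerBl enormZ.
apply: le_lt_trans xy; apply: ler_pM; rewrite ?enorm_ge0 ?lerDl//.
(* It remains to see that clamping to [[0, 1]] is 1-Lipschitz: with both signs of [x - y] bounded by
   [d], every case is linear. *)
have := ler_norm (y - x); rewrite distrC; have := ler_norm (x - y).
set d := `|x - y| => xyd yxd; rewrite ler_norml; apply/andP.
by case: (leP 0 x) => ?; case: (leP 0 y) => ?; case: (leP 1 x) => ?;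
  case: (leP 1 y) => ?; rewrite ?(min_idPr ler01); split; lra.
Qed.

Definition cub_ramp (v : 'cV[R]_n) : Cub R n := MkCub (ramp_subproof v).

End RampFunction.

(** Biorthogonality kills all components but the [k]-th, so such data is merely translated. *)
Lemma semigroup_ramp (R : realType) (n : nat) (M : 'M[R]_n) (E : eigensystem M)
    (k : 'I_n) (t x : R) :
  semigroup E t (cub_ramp (reig E k)) x = ramp (reig E k) (x + eigval E k * t).
Proof.
rewrite /= /semigroup_fun (bigD1 k)//= big1 ?addr0 => [|i ik].
  by rewrite dotvZr dotv_leig_reig eqxx mulr1.
by rewrite dotvZr dotv_leig_reig eq_sym (negbTE ik) mulr0 scale0r.
Qed.

(** Sup-norm convergence forces pointwise convergence: otherwise [enorm (g x)] would serve as a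
    contradictory epsilon. *)
Lemma cvg_cub_eq0 (R : realType) (n : nat) (u : nat -> Cub R n) (g : Cub R n)
    (x : R) :
  u @ \oo --> g -> (\forall m \near \oo, u m x = 0) -> g x = 0.
Proof.
move=> /cvgrPdist_lt ug u0; apply: enorm0_eq0; apply/eqP/negPn/negP => gx.
have gx0 : 0 < enorm (g x) by rewrite lt_def gx enorm_ge0.
have [m [/= ugm um0]] := filter_ex (filterI (ug _ gx0) u0).
have := le_lt_trans (enorm_le_supnorm (g - u m) x) ugm.
by rewrite [_ x](_ : _ = g x - u m x)// um0 subr0 ltxx.
Qed.

Theorem theorem2p3 (R : realType) (n : nat) (A B C : 'M[R]_n.+1)
    (EA : eigensystem A) (EB : eigensystem B) (EC : eigensystem C) :
  A \in unitmx -> B \in unitmx -> C \in unitmx ->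
  hyperbolic A -> hyperbolic B -> hyperbolic C ->
  C = A + B ->
  eigval EA ord_max + eigval EB ord_max < eigval EC ord_max ->
  let S := semigroup EA in let T := semigroup EB in let U := semigroup EC in
  exists f : Cub R n.+1, forall t : R, 0 < t ->
    ~ (iter m (S (t / m%:R) \o T (t / m%:R)) f @[m --> \oo] --> U t f).
Proof.
move=> _ _ _ _ _ _ _ ab_lt_c S T U.
(* The witness is independent of [t]; only the evaluation point [- (a * t)] varies. *)
exists (cub_ramp (reig EC ord_max)) => t t0 /cvg_cub_eq0.
set a := _ + _ in ab_lt_c; move=> /(_ (- (a * t))).
have -> : U t (cub_ramp (reig EC ord_max)) (- (a * t)) =
    ramp (reig EC ord_max) ((eigval EC ord_max - a) * t).
  by rewrite semigroup_ramp mulrBl addrC.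
move=> eq0; suff /(congr1 enorm)/eqP : ramp (reig EC ord_max)
    ((eigval EC ord_max - a) * t) = 0.
  rewrite enormZ enorm_reig mulr1 enorm0 normr_eq0 gt_eqF//.
  by rewrite lt_min ltr01 lt_max mulr_gt0 ?orbT// subr_gt0.
apply: eq0; near=> m.
(* At [m = 0] division by zero gives 0, and the steps would not add up to [t]. *)
have m0 : (0 < m)%N by near: m; exact: nbhs_infty_gt.
have ramp0 : vanishes_upto 0 (cub_ramp (reig EC ord_max)).
  move=> x x0 /=; rewrite /ramp (max_idPl x0) (min_idPr ler01).
  by rewrite scale0r.
have tm0 : 0 <= t / m%:R by rewrite divr_ge0 // ltW.
have tmm : (t / m%:R) *+ m = t.
  by rewrite -[LHS]mulr_natr divfK// pnatr_eq0 -lt0n.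
apply: (iter_semigroup_vanishes_upto tm0 ramp0).
by rewrite tmm sub0r.
Unshelve. all: by end_near. Qed.
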